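(* Let $X,Y$ have arbitrary supports and let their association follow the log-bilinear odds ratio model $\psi_\theta(x,y)=\tilde x^T\theta\,\tilde y$. Suppose sampling is conditional on $Y$ with a fixed set of conditioning values $y_0,\dots,y_K$, and let $(r_{jk})$, $0\le j\le J$, $0\le k\le K$, be the observed table of frequencies of the pairs $(x_j,y_k)$, where $x_0,\dots,x_J$ are the different observed $x$-values. Let $$l(\lambda)=\sum_{j=0}^J\sum_{k=0}^K r_{jk}\log p^*_k(x_j),\qquad p_k^*(x_j)=\frac{\exp(\gamma_k^*+\tilde x_j^T\theta\tilde y_k)}{\sum_{m=0}^K\exp(\gamma_m^*+\tilde x_j^T\theta\tilde y_m)},$$ with $\gamma_0^*=0$, $\lambda=(\gamma^*,\vec\theta)$, $\gamma^*=(\gamma_1^*,\dots,\gamma_K^* )$, let $\mathbf J(\lambda)=-\mathrm D^2_{\lambda\lambda}l(\lambda)$ be the negative Hessian, and let $\hat\lambda=(\hat\gamma^*,\vec{\hat\theta})$ be the maximum likelihood estimate (maximizer of $l$). Then $$\mathbf J^{-1}(\hat\lambda)=\hat\Sigma_{\hat\lambda}:=\begin{pmatrix} B^T\\ (Z^{\circ})^{-}C^T\end{pmatrix}\,[P^{\hat D}_{\mathscr H}-P^{\hat D}_{\mathscr R}]\,\hat D^{-1}\begin{pmatrix} B, & C\,(Z^{\circ})^{-T}\end{pmatrix},\qquad \hat D=\mathrm{diag}\{\vec{\hat\mu}\}.$$ In particular the estimated asymptotic covariance matrix $(\mathbf J^{-1}(\hat\lambda))_{\theta\theta}$ of $\vec{\hat\theta}$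 (the block of $\mathbf J^{-1}(\hat\lambda)$ belonging to $\vec\theta$) is $$(\mathbf J^{-1}(\hat\lambda))_{\theta\theta}=(Z^{\circ})^{-}C^TP^{\hat D}_{\mathscr H}\hat D^{-1}C\,(Z^{\circ})^{-T},$$ i.e. it coincides with the estimated asymptotic covariance matrix of $\vec{\hat\theta}$ in the log-linear contingency table model where $X$ and $Y$ have finite supports $\{x_0,\dots,x_J\}$ and $\{y_0,\dots,y_K\}$.
   Context: Odds ratio model: $\tilde x=h_X(x)\in\mathbb R^{L_X}$, $\tilde y=h_Y(y)\in\mathbb R^{L_Y}$ for given measurable maps $h_X,h_Y$; $\theta$ is an $L_X\times L_Y$ parameter matrix; the log-odds ratio function of a joint density $p$ with respect to reference values $x_0,y_0$ is $\psi(x,y)=\log\frac{p(x,y)p(x_0,y_0)}{p(x,y_0)p(x_0,y)}$, and the maps are chosen with $\tilde x_0=h_X(x_0)=0$, $\tilde y_0=h_Y(y_0)=0$. Write $\tilde x_j=h_X(x_j)$, $\tilde y_k=h_Y(y_k)$. The first observed values $x_0$ and $y_0$ serve as reference values. $J,K\ge1$. Sampling conditional on $Y$ means that for each $k$ an independent sample of size $r_{+k}=m_k\geq 1$ is drawn from the conditional distribution of $X$ given $Y=y_k$, independently over $k$. Notation: $\vec A$ is the vector obtained by stacking the columns of a matrix $A$; $I=(J+1)(K+1)$; tables indexed by $0\le j\le J,0\le k\le K$ are identified with vectors in $\mathbb R^I$ in this way. $\vec e_{jk}\in\mathbb R^I$ is the unit vector of the table with a one at $(j,k)$ and zeros elsewhere,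 $\vec e_{j+}=\sum_k\vec e_{jk}$, and $\mathscr R=\mathrm{span}\{\vec e_{0+},\dots,\vec e_{J+}\}$. $z_{jk}=\tilde y_k\otimes\tilde x_j\in\mathbb R^L$, $L=L_XL_Y$ (Kronecker product), so $\tilde x_j^T\theta\tilde y_k=z_{jk}^T\vec\theta$. $Z^\circ$ is the $JK\times L$ matrix with rows $z_{jk}^T$, $j,k>0$; it is assumed that the $J\times L_X$ matrix with rows $\tilde x_j^T$ $(j>0)$ has rank $L_X$ and the $K\times L_Y$ matrix with rows $\tilde y_k^T$ $(k>0)$ has rank $L_Y$, so $Z^\circ$ has rank $L$. $(Z^\circ)^-=((Z^\circ)^TZ^\circ)^{-1}(Z^\circ)^T$ and $(Z^\circ)^{-T}$ is its transpose. $C$ is the $I\times JK$ matrix with columns $c_{jk}=\vec e_{jk}+\vec e_{00}-\vec e_{j0}-\vec e_{0k}$, $j,k>0$ (ordered as the rows of $Z^\circ$); $B$ is the $I\times K$ matrix with columns $b_k=\vec e_{0k}-\vec e_{00}$, $k=1,\dots,K$. $\mathscr H\subset\mathbb R^I$ is the linear space of all $\vec\eta$ with $\eta_{jk}=\alpha+\rho_j+\gamma_k+z_{jk}^T\vec\theta$, $\rho_0=\gamma_0=0$, all other parameters arbitrary. For symmetric positive definite $D$ and a subspace $\mathscr M$, $P^D_{\mathscr M}$ is the matrix of the orthogonal projection onto $\mathscr M$ with respect to $\langle a,b\rangle_D=a^TDb$ ($P_{\mathscr M}$ if $D$ is the identity). $\hat\mu$ is the maximum likelihood estimate of the expected table in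 the log-linear model: the unique table with positive entries satisfying $\log\vec{\hat\mu}\in\mathscr H$ and $P_{\mathscr H}\vec{\hat\mu}=P_{\mathscr H}\vec r$; equivalently, the unique table with row totals $r_{j+}$, column totals $r_{+k}$ and log-odds ratios $\log\frac{\hat\mu_{jk}\hat\mu_{00}}{\hat\mu_{j0}\hat\mu_{0k}}=\tilde x_j^T\hat\theta\tilde y_k$. It is assumed that the maximum likelihood estimates exist. *)

(* Defs.v *)
From HB Require Import structures.
From mathcomp Require Import all_boot all_order all_algebra.
From mathcomp Require Import mxtens.
From mathcomp Require Import all_classical all_reals all_analysis.

Set Implicit Arguments.
Unset Strict Implicit.
Unset Printing Implicit Defensive.

Import Order.TTheory GRing.Theory Num.Theory.
Import numFieldNormedType.Exports.

Local Open Scope classical_set_scope.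
Local Open Scope ring_scope.

(* Column stacking.  The position of entry (j, k) of an m x n matrix is
   k * m + j, i.e. mxtens_index (k, j), so that stacking is compatible with
   the Kronecker product *t (the library's mxvec stacks rows instead). *)
Definition vec (R : Type) (m n : nat) (A : 'M[R]_(m, n)) : 'cV[R]_(n * m) :=
  \col_i A (mxtens_unindex i).2 (mxtens_unindex i).1.

Definition unvec (R : Type) (m n : nat) (v : 'cV[R]_(n * m)) : 'M[R]_(m, n) :=
  \matrix_(j, k) v (mxtens_index (k, j)) 0.

Lemma vecK (R : Type) (m n : nat) : cancel (@vec R m n) (@unvec R m n).
Proof. by move=> A; apply/matrixP => i j; rewrite !mxE mxtens_indexK. Qed.

Lemma unvecK (R : Type) (m n : nat) : cancel (@unvec R m n) (@vec R m n).
Proof.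
by move=> v; apply/matrixP => i j; rewrite !mxE ord1 -surjective_pairing mxtens_unindexK.
Qed.

(* The coefficients g_1, ..., g_n completed by g_0 = 0. *)
Definition with0 (R : nmodType) (n : nat) (g : 'cV[R]_n) (i : 'I_n.+1) : R :=
  if unlift ord0 i is Some i' then g i' 0 else 0.

Definition bilin (R : pzRingType) (m n : nat) (theta : 'M[R]_(m, n))
    (u : 'cV[R]_m) (v : 'cV[R]_n) : R :=
  (u^T *m theta *m v) 0 0.

Section Projection.
Context (R : realType) (n : nat).

Definition is_oproj (D : 'M[R]_n) (M : set 'cV[R]_n) (P : 'M[R]_n) : Prop :=
  (forall v : 'cV[R]_n, M (P *m v)) /\
  (forall v w : 'cV[R]_n, M w -> (v - P *m v)^T *m D *m w = 0).

(* The matrix of the orthogonal projection onto the subspace M with respect to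
   <a, b>_D = a^T D b.  For D symmetric positive definite there is exactly one
   matrix satisfying is_oproj D M, so that the default 0 is never used. *)
Definition oproj (D : 'M[R]_n) (M : set 'cV[R]_n) : 'M[R]_n :=
  xget 0 [set P | is_oproj D M P].

End Projection.

Section Calculus.
Context (R : realType) (n : nat).

Definition hessian (f : 'cV[R]_n -> R) (a : 'cV[R]_n) : 'M[R]_n :=
  \matrix_(i, j) 'D_(delta_mx i 0) (fun v => 'D_(delta_mx j 0) f v) a.

Definition is_maximizer (f : 'cV[R]_n -> R) (a : 'cV[R]_n) : Prop :=
  forall b, f b <= f a.

End Calculus.

Section Model.
Context (R : realType) (dX dY dO : measure_display).
Context (X : measurableType dX) (Y : measurableType dY).

(* X and Y are the (arbitrary) supports, hence densities are positive. *)
Definition joint_density (nuX : {sigma_finite_measure set X -> \bar R})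
    (nuY : {sigma_finite_measure set Y -> \bar R}) (p : X -> Y -> R) : Prop :=
  [/\ measurable_fun [set: X * Y] (fun z : X * Y => p z.1 z.2),
      forall x y, 0 < p x y
    & (\int[nuX \x nuY]_z (p z.1 z.2)%:E = 1)%E].

Definition log_odds_ratio (p : X -> Y -> R) (x0 : X) (y0 : Y) (x : X) (y : Y) : R :=
  ln ((p x y * p x0 y0) / (p x y0 * p x0 y)).

Definition cond_density (nuX : {sigma_finite_measure set X -> \bar R})
    (p : X -> Y -> R) (y : Y) (x : X) : R :=
  p x y / fine (\int[nuX]_u (p u y)%:E)%E.

(* For each k, m k draws from the conditional distribution of X given Y = y k,
   all draws being independent.  Independence is the product rule for the full
   finite family; subfamilies are covered by taking A k i = setT.  The
   conditional density at y k makes sense only if the marginal density of Y is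
   finite there, which otherwise holds just for almost every value of Y. *)
Definition sample_conditional_on_Y (Om : measurableType dO) (P : probability Om R)
    (nuX : {sigma_finite_measure set X -> \bar R}) (p : X -> Y -> R)
    (K : nat) (y : 'I_K.+1 -> Y) (m : 'I_K.+1 -> nat)
    (S : forall k, 'I_(m k) -> Om -> X) : Prop :=
  [/\ forall k, (\int[nuX]_u (p u (y k))%:E < +oo)%E,
      forall k i, measurable_fun [set: Om] (S k i),
      forall k i (A : set X), measurable A ->
        P (S k i @^-1` A) = (\int[nuX]_(u in A) (cond_density nuX p (y k) u)%:E)%E
    & forall A : (forall k, 'I_(m k) -> set X),
        (forall k i, measurable (A k i)) ->
        P [set w | forall k i, A k i (S k i w)] =
        (\prod_(k < K.+1) \prod_(i < m k) P (S k i @^-1` A k i))%E].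

End Model.

Section Table.
Context (R : realType) (LX LY J K : nat).
Context (xt : 'I_J.+1 -> 'cV[R]_LX) (yt : 'I_K.+1 -> 'cV[R]_LY).

Definition e_ (j : 'I_J.+1) (k : 'I_K.+1) : 'cV[R]_(K.+1 * J.+1) :=
  vec (delta_mx j k).

Definition e_row (j : 'I_J.+1) : 'cV[R]_(K.+1 * J.+1) := \sum_k e_ j k.

Definition spaceR : set 'cV[R]_(K.+1 * J.+1) :=
  [set v | v \in <<[seq e_row j | j : 'I_J.+1]>>%VS].

Definition z_ (j : 'I_J.+1) (k : 'I_K.+1) : 'cV[R]_(LY * LX) := yt k *t xt j.

Definition spaceH : set 'cV[R]_(K.+1 * J.+1) :=
  [set eta | exists (alpha : R) (rho : 'cV[R]_J) (gamma : 'cV[R]_K)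
               (theta : 'M[R]_(LX, LY)),
     eta = vec (\matrix_(j, k) (alpha + with0 rho j + with0 gamma k
                                + ((z_ j k)^T *m vec theta) 0 0))].

(* Rows of Zo and columns of C are indexed by the pairs j, k > 0, in the order
   of column stacking. *)
Definition Zo : 'M[R]_(K * J, LY * LX) :=
  \matrix_(i < K * J)
    (z_ (lift ord0 (mxtens_unindex i).2) (lift ord0 (mxtens_unindex i).1))^T.

Definition Zo_pinv : 'M[R]_(LY * LX, K * J) := invmx (Zo^T *m Zo) *m Zo^T.

Definition c_ (j : 'I_J.+1) (k : 'I_K.+1) : 'cV[R]_(K.+1 * J.+1) :=
  e_ j k + e_ ord0 ord0 - e_ j ord0 - e_ ord0 k.

Definition Cmx : 'M[R]_(K.+1 * J.+1, K * J) :=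
  \matrix_(a, i)
    c_ (lift ord0 (mxtens_unindex i).2) (lift ord0 (mxtens_unindex i).1) a 0.

Definition Bmx : 'M[R]_(K.+1 * J.+1, K) :=
  \matrix_(a, k) (e_ ord0 (lift ord0 k) - e_ ord0 ord0) a 0.

Section Likelihood.
Variable r : 'M[nat]_(J.+1, K.+1).

Definition pstar (lam : 'cV[R]_(K + LY * LX)) (j : 'I_J.+1) (k : 'I_K.+1) : R :=
  let w k' := expR (with0 (usubmx lam) k' + bilin (unvec (dsubmx lam)) (xt j) (yt k')) in
  w k / \sum_k' w k'.

Definition loglik (lam : 'cV[R]_(K + LY * LX)) : R :=
  \sum_j \sum_k (r j k)%:R * ln (pstar lam j k).

Definition observed_info (lam : 'cV[R]_(K + LY * LX)) : 'M[R]_(K + LY * LX) :=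
  - hessian loglik lam.

(* The maximum likelihood table of the log-linear model. *)
Definition is_ml_table (mu : 'M[R]_(J.+1, K.+1)) : Prop :=
  [/\ forall j k, 0 < mu j k,
      spaceH (vec (\matrix_(j, k) ln (mu j k)))
    & oproj 1%:M spaceH *m vec mu =
      oproj 1%:M spaceH *m vec (\matrix_(j, k) (r j k)%:R)].

(* The log-linear contingency table model, X and Y having the finite supports
   {x_0, ..., x_J} and {y_0, ..., y_K}, under sampling conditional on Y:
   log P(X = x_j | Y = y_k) = rho_j + z_jk^T theta - (normalization), rho_0 = 0,
   with parameter (rho, vec theta). *)
Definition fin_prob (lam : 'cV[R]_(J + LY * LX)) (j : 'I_J.+1) (k : 'I_K.+1) : R :=
  let w j' := expR (with0 (usubmx lam) j' + ((z_ j' k)^T *m dsubmx lam) 0 0) in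
  w j / \sum_j' w j'.

Definition fin_loglik (lam : 'cV[R]_(J + LY * LX)) : R :=
  \sum_j \sum_k (r j k)%:R * ln (fin_prob lam j k).

Definition fin_observed_info (lam : 'cV[R]_(J + LY * LX)) : 'M[R]_(J + LY * LX) :=
  - hessian fin_loglik lam.

End Likelihood.

Definition Sigma_hat (mu : 'M[R]_(J.+1, K.+1)) : 'M[R]_(K + LY * LX) :=
  let D := diag_mx (vec mu)^T in
  col_mx Bmx^T (Zo_pinv *m Cmx^T)
    *m (oproj D spaceH - oproj D spaceR) *m invmx D
    *m row_mx Bmx (Cmx *m Zo_pinv^T).

Definition Sigma_theta (mu : 'M[R]_(J.+1, K.+1)) : 'M[R]_(LY * LX) :=
  let D := diag_mx (vec mu)^T in
  Zo_pinv *m Cmx^T *m oproj D spaceH *m invmx D *m Cmx *m Zo_pinv^T.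

End Table.

(* Main.v *)
Require Import Defs.
From HB Require Import structures.
From mathcomp Require Import all_boot all_order all_algebra.
From mathcomp Require Import mxtens.
From mathcomp Require Import all_classical all_reals all_analysis.
From mathcomp Require Import ring.

(* Both likelihoods are conditional logit likelihoods on the cells of the table,
   grouped by rows (given X) or by columns (given Y).  With design matrix A, fit
   mu and D = diag mu, the negative Hessian is A^T D (1 - M) A, where M averages
   within the groups.  The likelihood equations say that mu and r differ by a
   vector orthogonal to H, so by strict monotonicity of the logarithm the fit is
   the maximum likelihood table of the log-linear model.

   The matrix G = (B, C Z^{-T}) is a left inverse of the design, G^T A = 1, and
   annihilates the functions of the group.  As H is the sum of these functions
   and the range of A, (1 - M) A G^T P_H = P_H - M, and self-adjointness of M and
   P_H yields A^T D (1 - M) A . G^T P_H D^{-1} G = ((P_H - M) A)^T G = 1.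
   Grouping by columns changes B but neither the table mu nor the block of G that
   belongs to theta, which is why the two theta-blocks agree. *)

Set Implicit Arguments.
Unset Strict Implicit.
Unset Printing Implicit Defensive.

Import Order.TTheory GRing.Theory Num.Theory.
Import numFieldNormedType.Exports.

Local Open Scope classical_set_scope.
Local Open Scope ring_scope.

(** * Directional derivatives and stationarity at a maximizer *)

(** Both difference quotients are the same function, so directional calculus reduces to calculus in
    one real variable. *)
Lemma is_derive_line (R : realType) (V : normedModType R) (f : V -> R)
    (a v : V) (t d : R) :
  is_derive t (1 : R) (fun h : R => f (h *: v + a)) d <->
  is_derive (t *: v + a) v f d.
Proof.
have E : (fun h : R => h^-1 *: ((f \o shift (t *: v + a)) (h *: v) -
                                f (t *: v + a))) =
         (fun h : R => h^-1 *: (((fun h : R => f (h *: v + a)) \o shift t)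
                                  (h *: (1 : R)) - f (t *: v + a))).
  by apply/funext => h /=; rewrite scalerDl -addrA /GRing.scale/= mulr1.
split=> -[dv dval]; first by split; [rewrite /derivable E|rewrite /derive E].
by split; [rewrite /derivable -E|rewrite /derive -E].
Qed.

Lemma is_derive_sumf (R : realType) (V : normedModType R) (I : Type)
    (s : seq I) (P : pred I) (f : I -> V -> R) (df : I -> R) (x v : V) :
  (forall i, is_derive x v (f i) (df i)) ->
  is_derive x v (fun y => \sum_(i <- s | P i) f i y)
    (\sum_(i <- s | P i) df i).
Proof.
move=> H; rewrite -fct_sumE.
by elim/big_ind2 : _ => // [|a b c d];
  [exact: is_derive_cst|exact: is_deriveD].
Qed.

Lemma is_derive_comp1 (R : realType) (V : normedModType R) (f : R -> R)
    (h : V -> R) (a v : V) (df dh : R) :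
  is_derive (h a) 1 f df -> is_derive a v h dh ->
  is_derive a v (f \o h) (df * dh).
Proof.
move=> Hf Hh.
have Ea : 0 *: v + a = a by rewrite scale0r add0r.
rewrite -Ea; apply/is_derive_line.
apply: (@is_derive1_comp R f (fun t : R => h (t *: v + a))); rewrite ?Ea//.
by apply/is_derive_line; rewrite Ea.
Qed.

Lemma derive_maximizer (R : realType) (n : nat) (f : 'cV[R]_n -> R)
    (a v : 'cV[R]_n) (df : 'cV[R]_n -> R) :
  (forall b, is_derive b v f (df b)) -> is_maximizer f a -> df a = 0.
Proof.
move=> fd fmax.
have lined t : is_derive t (1 : R) (fun h : R => f (h *: v + a))
    (df (t *: v + a)) by apply/is_derive_line; exact: fd.
(* Any open interval around 0 would serve: on the line through [a], the maximum is attained at the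
   parameter 0. *)
have c01 : (0 : R) \in `](-1), 1[%R by rewrite in_itv/= ltrN10 ltr01.
have dmax : is_derive (0 : R) (1 : R) (fun h : R => f (h *: v + a)) 0.
  apply: (@derive1_at_max _ _ (-1) 1 0) => // t _.
  by rewrite scale0r add0r; exact: fmax.
have [_] := dmax; have [_ ->] := lined 0.
by rewrite scale0r add0r.
Qed.

(* Conditional logit likelihood: [A] is the design matrix, the cells with the
   same value of [g] form a group, and [gprob] is the softmax of the linear
   predictor within each group.  Taking the rows of a table as groups gives the
   likelihood [loglik], taking the columns gives [fin_loglik]. *)
Section GroupedLogit.
Context (R : realType) (n q N : nat) (g : 'I_n -> 'I_q).
Context (A : 'M[R]_(n, N)) (r : 'I_n -> R).

Definition gtotal (lam : 'cV[R]_N) (i : 'I_n) : R :=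
  \sum_(i' | g i' == g i) expR ((A *m lam) i' 0).

Definition gprob (lam : 'cV[R]_N) (i : 'I_n) : R :=
  expR ((A *m lam) i 0) / gtotal lam i.

Definition gloglik (lam : 'cV[R]_N) : R := \sum_i r i * ln (gprob lam i).

Definition gsize (i : 'I_n) : R := \sum_(i' | g i' == g i) r i'.

Definition gfit (lam : 'cV[R]_N) (i : 'I_n) : R := gsize i * gprob lam i.

(* The averages within the groups; for the weights [gfit] this is the orthogonal
   projection onto the functions of the group. *)
Definition gmean (lam : 'cV[R]_N) : 'M[R]_n :=
  \matrix_(i, i') ((g i' == g i)%:R * gprob lam i').

Lemma gtotal_gt0 lam i : 0 < gtotal lam i.
Proof.
rewrite /gtotal (bigD1 i) //= ltr_pwDl ?expR_gt0//.
by apply: sumr_ge0 => k _; exact: expR_ge0.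
Qed.

Lemma gprob_gt0 lam i : 0 < gprob lam i.
Proof. by rewrite divr_gt0 ?expR_gt0 ?gtotal_gt0. Qed.

Lemma gtotal_eq lam i i' : g i' = g i -> gtotal lam i' = gtotal lam i.
Proof. by rewrite /gtotal => ->. Qed.

Lemma gsize_eq i i' : g i' = g i -> gsize i' = gsize i.
Proof. by rewrite /gsize => ->. Qed.

Lemma sum_gprob lam i : \sum_(i' | g i' == g i) gprob lam i' = 1.
Proof.
rewrite /gprob.
under eq_bigr => i' /eqP E do rewrite (gtotal_eq _ E).
by rewrite -mulr_suml divff // gt_eqF // gtotal_gt0.
Qed.

Lemma ln_gprob lam i : ln (gprob lam i) = (A *m lam) i 0 - ln (gtotal lam i).
Proof. by rewrite /gprob ln_div ?posrE ?expR_gt0 ?gtotal_gt0// expRK. Qed.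

Lemma gmeanE lam (v : 'cV[R]_n) i :
  (gmean lam *m v) i 0 = \sum_(i' | g i' == g i) gprob lam i' * v i' 0.
Proof.
rewrite mxE [RHS]big_mkcond; apply: eq_bigr => i' _.
by rewrite mxE; case: eqP; rewrite ?mul1r ?mul0r.
Qed.

(** * Score and Hessian of the grouped likelihood *)

Lemma is_derive_linpred (a v : 'cV[R]_N) i :
  is_derive a v (fun lam => (A *m lam) i 0) ((A *m v) i 0).
Proof.
suff : is_derive (0 *: v + a) v (fun lam => (A *m lam) i 0) ((A *m v) i 0).
  by rewrite scale0r add0r.
apply/is_derive_line.
have -> : (fun h : R => (A *m (h *: v + a)) i 0) =
          (fun h : R => h * (A *m v) i 0 + (A *m a) i 0).
  by apply/funext => h; rewrite mulmxDr -scalemxAr !mxE.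
by apply: is_derive_eq; rewrite /GRing.scale/= mulr1; ring.
Qed.

(** The total is factored out so that the logarithmic derivative is the group mean of the
    predictor. *)
Lemma is_derive_gtotal (a v : 'cV[R]_N) i :
  is_derive a v (gtotal^~ i) (gtotal a i * (gmean a *m (A *m v)) i 0).
Proof.
rewrite gmeanE mulr_sumr.
have -> : \sum_(i' | g i' == g i) gtotal a i * (gprob a i' * (A *m v) i' 0) =
          \sum_(i' | g i' == g i) expR ((A *m a) i' 0) * (A *m v) i' 0.
  apply: eq_bigr => i' /eqP E; rewrite /gprob (gtotal_eq _ E) mulrA mulrCA.
  by rewrite divff ?mulr1 // gt_eqF // gtotal_gt0.
apply: is_derive_sumf => i'.
exact: (is_derive_comp1 (is_derive_expR _) (is_derive_linpred _ _ _)).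
Qed.

Lemma is_derive_ln_gprob (a v : 'cV[R]_N) i :
  is_derive a v (fun lam => ln (gprob lam i))
    ((A *m v - gmean a *m (A *m v)) i 0).
Proof.
have -> : (fun lam => ln (gprob lam i)) =
    (fun lam => (A *m lam) i 0) - (ln (R:=R) \o gtotal^~ i).
  by apply/funext => lam; rewrite ln_gprob.
have -> : (A *m v - gmean a *m (A *m v)) i 0 =
    (A *m v) i 0 - (gtotal a i)^-1 * (gtotal a i * (gmean a *m (A *m v)) i 0).
  by rewrite mulKf ?gt_eqF ?gtotal_gt0// !mxE.
apply: is_deriveB; first exact: is_derive_linpred.
apply: is_derive_comp1; last exact: is_derive_gtotal.
by apply: is_derive1_ln; exact: gtotal_gt0.
Qed.

Lemma is_derive_gprob (a v : 'cV[R]_N) i :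
  is_derive a v (gprob^~ i)
    (gprob a i * (A *m v - gmean a *m (A *m v)) i 0).
Proof.
have -> : gprob^~ i = expR \o (fun lam => ln (gprob lam i)).
  by apply/funext => lam /=; rewrite lnK // posrE gprob_gt0.
have {1}<- : expR (ln (gprob a i)) = gprob a i by rewrite lnK // posrE gprob_gt0.
exact: (is_derive_comp1 (is_derive_expR _) (is_derive_ln_gprob _ _ _)).
Qed.

Lemma is_derive_gloglik (a v : 'cV[R]_N) :
  is_derive a v gloglik (\sum_i (r i - gfit a i) * (A *m v) i 0).
Proof.
have -> : \sum_i (r i - gfit a i) * (A *m v) i 0 =
          \sum_i r i * (A *m v - gmean a *m (A *m v)) i 0.
  under eq_bigr do rewrite mulrBl.
  have mxB (x y : 'cV[R]_n) i : (x - y) i 0 = x i 0 - y i 0 by rewrite !mxE.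
  under [RHS]eq_bigr do rewrite mxB mulrBr.
  rewrite !sumrB; congr (_ - _); rewrite /gfit /gsize.
  under eq_bigr do rewrite -mulrA mulr_suml big_mkcond.
  (* Exchanging the sums moves the averaging from the predictor to the counts, where it turns [r]
     into [gfit]. *)
  rewrite exchange_big /=; apply: eq_bigr => i _.
  rewrite [X in _ = _ * X]gmeanE mulr_sumr [RHS]big_mkcond.
  apply: eq_bigr => i' _.
  by rewrite eq_sym.
apply: is_derive_sumf => i.
exact: (@is_deriveZ _ _ _ _ (r i) _ _ _ (is_derive_ln_gprob _ _ _)).
Qed.

(** In the score only [gfit] depends on the parameter, so differentiation centres just one of the
    two design factors. *)
Lemma hessian_gloglik (a : 'cV[R]_N) :
  - hessian gloglik a =
  (A - gmean a *m A)^T *m diag_mx (\row_i gfit a i) *m A.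
Proof.
apply/matrixP => u v; rewrite !mxE.
set du : 'cV[R]_N := delta_mx u 0; set dv : 'cV[R]_N := delta_mx v 0.
have -> : (fun lam => 'D_dv gloglik lam) =
   (fun lam => \sum_i (r i - gfit lam i) * (A *m dv) i 0).
  by apply/funext => lam; have [_] := is_derive_gloglik lam dv.
have H : is_derive a du (fun lam => \sum_i (r i - gfit lam i) * (A *m dv) i 0)
    (\sum_i (A *m dv) i 0 *
       (0 - gsize i * (gprob a i * (A *m du - gmean a *m (A *m du)) i 0))).
  apply: is_derive_sumf => i.
  have -> : (fun lam => (r i - gfit lam i) * (A *m dv) i 0) =
     (A *m dv) i 0 \*: (cst (r i) - gsize i \*: gprob^~ i).
    by apply/funext => lam; rewrite mulrC.
  apply: is_deriveZ; apply: is_deriveB.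
  by apply: is_deriveZ; exact: is_derive_gprob.
have [_ ->] := H.
rewrite -sumrN; apply: eq_bigr => i _.
rewrite sub0r mulrN opprK mulmxA -mulmxBl /du /dv -!colE mulrC.
rewrite mul_mx_diag !mxE /gfit; ring.
Qed.

Lemma gloglik_score (a v : 'cV[R]_N) : is_maximizer gloglik a ->
  \sum_i (r i - gfit a i) * (A *m v) i 0 = 0.
Proof. exact: (derive_maximizer (is_derive_gloglik^~ v)). Qed.

End GroupedLogit.

(** * Orthogonal projections for a positive diagonal weight *)

Lemma mulmx_bilin_eq0 (R : realType) (k l : nat) (B : 'M[R]_(k, l)) :
  (forall (v : 'cV_k) (w : 'cV_l), v^T *m B *m w = 0) -> B = 0.
Proof.
move=> B0; apply/matrixP => i j.
have := B0 (delta_mx i 0) (delta_mx j 0).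
by rewrite trmx_delta -rowE -colE => /matrixP/(_ 0 0); rewrite !mxE.
Qed.

Section WeightedProjection.
Context (R : realType) (n : nat) (d : 'rV[R]_n) (d_gt0 : forall i, 0 < d 0 i).

Lemma diag_mx_unit_gt0 : diag_mx d \in unitmx.
Proof.
rewrite unitmxE det_diag unitfE prodf_seq_neq0.
by apply/allP => i _; rewrite gt_eqF.
Qed.

Lemma diag_form_eq0 (v : 'cV[R]_n) : v^T *m diag_mx d *m v = 0 -> v = 0.
Proof.
move=> /matrixP/(_ 0 0); rewrite mul_mx_diag !mxE => v0.
have v2 i : true -> 0 <= v i 0 * d 0 i * v i 0.
  by move=> _; rewrite mulrAC mulr_ge0 ?sqr_ge0 ?ltW// -expr2 sqr_ge0.
have {v0} : \sum_i v i 0 * d 0 i * v i 0 == 0.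
  by apply/eqP; rewrite -[RHS]v0; apply: eq_bigr => i _; rewrite !mxE.
rewrite psumr_eq0 // => /allP v0.
apply/matrixP => i j; rewrite ord1 mxE.
have := v0 i; rewrite mem_index_enum => /(_ isT) /=.
by rewrite !mulf_eq0 (gt_eqF (d_gt0 _)) orbF orbb => /eqP.
Qed.

(** A vector in the kernel gives a zero of the definite form at its image under [F^T], and [F] is
    injective on rows. *)
Lemma gram_unitmx (k : nat) (F : 'M[R]_(k, n)) :
  row_free F -> F *m diag_mx d *m F^T \in unitmx.
Proof.
move=> freeF; rewrite -row_free_unit; apply: inj_row_free => v v0.
apply: (row_free_inj freeF); rewrite mul0mx; apply: trmx_inj; rewrite trmx0.
apply: diag_form_eq0; rewrite trmxK trmx_mul.
by rewrite !mulmxA -(mulmxA v) -(mulmxA v) v0 mul0mx.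
Qed.

Lemma oprojP (q : nat) (W : 'M[R]_(n, q)) (M : set 'cV[R]_n) :
  (forall h, M h <-> exists v, h = W *m v) ->
  is_oproj (diag_mx d) M (oproj (diag_mx d) M).
Proof.
move=> MW; apply: xgetPex.
(* The columns of [W] may be dependent; a basis of their span makes the Gram matrix invertible. *)
have [k [F [freeF [T1 WF] [T2 FW]]]] : exists k (F : 'M[R]_(k, n)),
    [/\ row_free F, exists T, W^T = T *m F & exists T, F = T *m W^T].
  exists (\rank W^T), (row_base W^T); split; first exact: row_base_free.
    by apply/submxP; rewrite eq_row_base.
  by apply/submxP; rewrite eq_row_base.
pose N := F *m diag_mx d *m F^T.
have Nu : N \in unitmx by exact: gram_unitmx.
have NT : N^T = N by rewrite /N !trmx_mul trmxK tr_diag_mx mulmxA.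
(* The weighted least squares projection onto the span of the basis. *)
exists (F^T *m invmx N *m F *m diag_mx d); split => [v|v w].
  by apply/MW; rewrite FW trmx_mul trmxK; eexists; rewrite -!mulmxA.
move=> /MW[u ->]; rewrite -[W]trmxK WF trmx_mul linearB /= !mulmxBl.
rewrite !trmx_mul tr_diag_mx trmx_inv NT trmxK -!mulmxA.
rewrite (mulmxA F) (mulmxA (F *m _)) -/N (mulmxA (invmx N)) mulVmx // mul1mx.
by rewrite subrr.
Qed.

Context (M : set 'cV[R]_n) (P : 'M[R]_n) (MP : is_oproj (diag_mx d) M P).

(** Orthogonality tested on vectors [P *m w] gives [D P = P^T D P], whose right side is
    symmetric. *)
Lemma oproj_adj : diag_mx d *m P = P^T *m diag_mx d.
Proof.
have PDP : diag_mx d *m P = P^T *m diag_mx d *m P.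
  apply/eqP; rewrite -subr_eq0; apply/eqP; apply: mulmx_bilin_eq0 => v w.
  have := MP.2 v (P *m w) (MP.1 w).
  rewrite linearB /= trmx_mul !mulmxBl mulmxBr mulmxBl => <-.
  by rewrite !mulmxA.
have := congr1 trmx PDP; rewrite !trmx_mul trmxK tr_diag_mx => ->.
by rewrite mulmxA.
Qed.

(** The residual of [w] is orthogonal to both [w] and [P *m w], hence to itself. *)
Lemma oproj_id (w : 'cV[R]_n) : M w -> P *m w = w.
Proof.
move=> Mw; apply/eqP; rewrite eq_sym -subr_eq0; apply/eqP; apply: diag_form_eq0.
by rewrite mulmxBr (MP.2 _ _ Mw) (MP.2 _ _ (MP.1 _)) subrr.
Qed.

Lemma oproj_idmx (k : nat) (W : 'M[R]_(n, k)) :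
  (forall v : 'cV_k, M (W *m v)) -> P *m W = W.
Proof.
move=> MW; apply/eqP; rewrite -subr_eq0; apply/eqP/mulmx_bilin_eq0 => v w.
by rewrite mulmxBr mulmxBl -!mulmxA oproj_id // subrr.
Qed.

End WeightedProjection.

(** * Uniqueness of the fitted table *)

Lemma leif_mulB_lnB (R : realType) (x y : R) : 0 < x -> 0 < y ->
  0 <= (x - y) * (ln x - ln y) ?= iff (x == y).
Proof.
move=> x0 y0; apply/leifP; case: (ltgtP x y) => [xy|yx|->].
- by rewrite nmulr_lgt0 subr_lt0 // ltr_ln.
- by rewrite pmulr_rgt0 subr_gt0 // ltr_ln.
- by rewrite subrr mul0r.
Qed.

(* The log-linear analogue of strict concavity: two fitted tables with the same
   sufficient statistics agree. *)
Lemma ml_fit_unique (R : realType) (n : nat) (mu nu : 'cV[R]_n) :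
  (forall i, 0 < mu i 0) -> (forall i, 0 < nu i 0) ->
  (mu - nu)^T *m (\col_i (ln (mu i 0) - ln (nu i 0))) = 0 -> mu = nu.
Proof.
move=> mu0 nu0 /matrixP/(_ 0 0); rewrite !mxE => E.
have {E} : \sum_i (mu i 0 - nu i 0) * (ln (mu i 0) - ln (nu i 0)) == 0.
  by apply/eqP; rewrite -[RHS]E; apply: eq_bigr => i _; rewrite !mxE.
rewrite psumr_eq0; last by move=> i _; rewrite leif_mulB_lnB.
move=> /allP E; apply/matrixP => i j; rewrite ord1.
have := E i; rewrite mem_index_enum => /(_ isT) /=.
by rewrite eq_sym (leif_mulB_lnB (mu0 i) (nu0 i)) => /eqP.
Qed.

(** * Inverting the information matrix of a grouped likelihood *)

Section GroupedInformation.
Context (R : realType) (n q N : nat) (g : 'I_n -> 'I_q).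
Context (A G : 'M[R]_(n, N)) (r : 'I_n -> R).

(** The range of this matrix is the space of functions of the group. *)
Definition gind : 'M[R]_(n, q) := \matrix_(i, k) (k == g i)%:R.

Lemma gindE (rho : 'cV[R]_q) i : (gind *m rho) i 0 = rho (g i) 0.
Proof.
rewrite mxE (bigD1 (g i)) //= big1 => [|k /negbTE E].
  by rewrite mxE eqxx mul1r addr0.
by rewrite mxE E mul0r.
Qed.

Hypothesis size_gt0 : forall i, 0 < gsize g r i.

Section Fit.
Context (lam : 'cV[R]_N).
Let M := gmean g A lam.
Let D := diag_mx (\row_i gfit g A r lam i).

Lemma gfit_gt0 i : 0 < gfit g A r lam i.
Proof. by rewrite mulr_gt0 ?gprob_gt0. Qed.

Lemma gmean_gind (rho : 'cV[R]_q) : M *m (gind *m rho) = gind *m rho.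
Proof.
apply/matrixP => i j; rewrite ord1 gmeanE gindE.
under eq_bigr => i' /eqP E do rewrite gindE E.
by rewrite -mulr_suml sum_gprob mul1r.
Qed.

(** Averages are functions of the group; hence whatever annihilates [gind] annihilates [M]. *)
Lemma gmean_factor : exists T, M = gind *m T.
Proof.
exists (\matrix_(k, i) ((g i == k)%:R * gprob g A lam i)).
apply/matrixP => i i'; rewrite !mxE (bigD1 (g i)) //= big1 => [|k /negbTE E].
  by rewrite !mxE eqxx mul1r addr0.
by rewrite !mxE E mul0r.
Qed.

(** Within a group, the entries of [D *m M] are the group size times a product of two probabilities,
    which is symmetric. *)
Lemma gmean_adj : D *m M = M^T *m D.
Proof.
rewrite mul_diag_mx mul_mx_diag; apply/matrixP => i i'; rewrite !mxE /gfit.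
rewrite eq_sym; case: eqP => E; last by rewrite !(mul0r, mulr0).
by rewrite (gsize_eq _ E); ring.
Qed.

End Fit.

Context (H : set 'cV[R]_n) (mu : 'cV[R]_n) (lam : 'cV[R]_N).
Hypothesis HP : forall h, H h <-> exists rho v, h = gind *m rho + A *m v.
Hypothesis GA : G^T *m A = 1%:M.
Hypothesis GE : G^T *m gind = 0.
Hypothesis lam_max : is_maximizer (gloglik g A r) lam.
Hypothesis mu_gt0 : forall i, 0 < mu i 0.
Hypothesis mu_H : H (\col_i ln (mu i 0)).
Hypothesis mu_r : forall h, H h -> (mu - \col_i r i)^T *m h = 0.

(* The logarithm of the fit is the linear predictor plus a function of the group,
   hence lies in [H]; the likelihood equations then make it the table [mu]. *)
Lemma ml_gfit : mu = \col_i gfit g A r lam i.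
Proof.
have [rho0 [v0 Emu]] := (HP _).1 mu_H.
have Hdiff : exists rho v, \col_i (ln (mu i 0) - ln (gfit g A r lam i)) =
    gind *m rho + A *m v.
  (* [S] and [T] are the group size and the normalizing total, indexed by the group:
     [ln (S k) - ln (T k)] is the group part of the log fit. *)
  pose S k := \sum_(i | g i == k) r i.
  pose T k := \sum_(i | g i == k) expR ((A *m lam) i 0).
  exists (rho0 - \col_k (ln (S k) - ln (T k))), (v0 - lam).
  apply/matrixP => i j; rewrite ord1 mulmxBr !mulmxBr.
  move/matrixP: Emu => /(_ i 0); rewrite mxE => Emu.
  rewrite mxE Emu lnM ?posrE ?gprob_gt0 //.
  rewrite ln_gprob.
  have -> : gsize g r i = S (g i) by [].
  have -> : gtotal g A lam i = T (g i) by [].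
  have mxD (x y : 'cV[R]_n) k : (x + y) k 0 = x k 0 + y k 0 by rewrite !mxE.
  have mxN (x : 'cV[R]_n) k : (- x) k 0 = - x k 0 by rewrite !mxE.
  rewrite !mxD !mxN !gindE [(\col_k _) _ _]mxE; ring.
have {}Hdiff := (HP _).2 Hdiff.
apply: ml_fit_unique => //.
  by move=> i; rewrite mxE gfit_gt0.
set h := \col_i _ in Hdiff *.
have -> : (\col_i (ln (mu i 0) - ln ((\col_i0 gfit g A r lam i0) i 0))) = h.
  by apply/matrixP => i j; rewrite !mxE.
(* The first difference is orthogonal to [H] by [mu_r]; the second is handled separately on the
   ranges of [A] (score equations) and [gind]. *)
have -> : mu - \col_i gfit g A r lam i =
  (mu - \col_i r i) + (\col_i (r i - gfit g A r lam i)).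
  by apply/matrixP => i j; rewrite !mxE; ring.
rewrite linearD /= mulmxDl mu_r // add0r.
have [rho [v ->]] := (HP _).1 Hdiff.
rewrite mulmxDr; apply/matrixP => i j; rewrite !ord1 !mxE.
under eq_bigr do rewrite !mxE.
under [X in _ + X]eq_bigr do rewrite 2!mxE.
rewrite gloglik_score // addr0.
(* On functions of the group it remains to see that the fit reproduces the group totals, which holds
   for every parameter. *)
have -> : \sum_i (r i - gfit g A r lam i) * (\sum_k gind i k * rho k 0) =
  \sum_i (r i - gfit g A r lam i) * rho (g i) 0.
  by apply: eq_bigr => k _; rewrite -gindE [in RHS]mxE.
under eq_bigr do rewrite mulrBl.
rewrite sumrB; apply/eqP; rewrite subr_eq0; apply/eqP.
rewrite (partition_big g xpredT) //= [RHS](partition_big g xpredT) //=.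
apply: eq_bigr => k _.
under eq_bigr => i' /eqP -> do over.
under [RHS]eq_bigr => i' /eqP -> do over.
rewrite -!mulr_suml; congr (_ * _); rewrite /gfit.
(* A value of [g] that is not attained contributes empty sums. *)
case: (pickP (fun i => g i == k)) => [i0 /eqP Ei0|none]; last first.
  by rewrite !big_pred0.
under [RHS]eq_bigr => i' /eqP E do rewrite (gsize_eq r (etrans E (esym Ei0))).
rewrite -mulr_sumr -Ei0 sum_gprob mulr1; reflexivity.
Qed.

Lemma ginfo_mul :
  let D := diag_mx mu^T in
  - hessian (gloglik g A r) lam *m (G^T *m oproj D H *m invmx D *m G) = 1%:M.
Proof.
move=> D; rewrite hessian_gloglik.
set M := gmean g A lam; set P := oproj D H.
have ED : diag_mx (\row_i gfit g A r lam i) = D.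
  by rewrite /D ml_gfit; congr diag_mx; apply/matrixP => i j; rewrite !mxE.
rewrite ED.
have d_gt0 i : 0 < mu^T 0 i by rewrite mxE.
have PP : is_oproj D H P.
  apply: (@oprojP _ _ _ d_gt0 _ (row_mx gind A)) => h; split.
    by move=> /HP[rho [v ->]]; exists (col_mx rho v); rewrite mul_row_col.
  move=> [v ->]; apply/HP; exists (usubmx v), (dsubmx v).
  by rewrite -mul_row_col vsubmxK.
have DM : D *m M = M^T *m D by rewrite -ED gmean_adj.
have DP : D *m P = P^T *m D := oproj_adj PP.
have [T MT] := gmean_factor lam; rewrite -/M in MT.
have GM : G^T *m M = 0 by rewrite MT mulmxA GE mul0mx.
have PA : P *m A = A.
  apply: (oproj_idmx d_gt0 PP) => v; apply/HP; exists 0, v.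
  by rewrite mulmx0 add0r.
have PM : P *m M = M.
  apply: (oproj_idmx d_gt0 PP) => v; apply/HP; exists (T *m v), 0.
  by rewrite mulmx0 addr0 MT mulmxA.
have Du : D \in unitmx by exact: diag_mx_unit_gt0.
(* This is the adjoint of [PM] with respect to [D]. *)
have MP : M *m P = M.
  apply: (can_inj (mulKmx Du)).
  by rewrite mulmxA DM -mulmxA DP mulmxA -trmx_mul PM.
(* Write [P *m v] as [gind *m rho + A *m u]: [G^T] extracts [u], while [1 - M] removes the part with
   [rho]. *)
have key : (A - M *m A) *m G^T *m P = P - M.
  have keyv (v : 'cV[R]_n) : (A - M *m A) *m G^T *m P *m v = (P - M) *m v.
    have [rho [u Pv]] := (HP _).1 (PP.1 v).
    rewrite [RHS]mulmxBl -{2}MP -!mulmxA Pv !mulmxDr !(mulmxA G^T) GE GA.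
    rewrite gmean_gind mul0mx mulmx0 add0r mul1mx opprD addrACA.
    by rewrite subrr add0r mulmxBl -mulmxA.
  apply/eqP; rewrite -subr_eq0; apply/eqP/mulmx_bilin_eq0 => w v.
  by rewrite -mulmxA mulmxBl keyv subrr mulmx0.
(* Self-adjointness of [M] moves the centring next to [G^T], so that [key] applies. *)
have -> : (A - M *m A)^T *m D *m A = A^T *m D *m (A - M *m A).
  rewrite linearB /= trmx_mul mulmxBl mulmxBr mulmxBl -mulmxA; congr (_ - _).
  by rewrite -!mulmxA [M^T *m _]mulmxA -DM !mulmxA.
have DPM : D *m (P - M) = (P - M)^T *m D.
  by rewrite mulmxBr DP DM linearB /= mulmxBl.
have -> : A^T *m D *m (A - M *m A) *m (G^T *m P *m invmx D *m G) =
    A^T *m (D *m ((A - M *m A) *m G^T *m P)) *m invmx D *m G by rewrite !mulmxA.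
(* With [D] cancelled, [((P - M) A)^T G] remains, the transpose of [G^T A - G^T M A = 1 - 0]. *)
rewrite key DPM mulmxA mulmxK // -trmx_mul mulmxBl PA -[G in LHS]trmxK -trmx_mul.
by rewrite mulmxBr GA mulmxA GM mul0mx subr0 trmx1.
Qed.

End GroupedInformation.

(** * Cells, designs and spaces of the two-way table *)

Lemma drsubmx_form (R : pzRingType) (n k l : nat) (B : 'M[R]_(n, k))
    (E : 'M[R]_(n, l)) (X : 'M[R]_n) :
  drsubmx ((row_mx B E)^T *m X *m row_mx B E) = E^T *m X *m E.
Proof.
rewrite tr_row_mx mul_col_mx mul_col_row; exact: block_mxKdr.
Qed.

Lemma sum_mxtens (R : nmodType) (m n : nat) (F : 'I_(m * n) -> R) :
  \sum_i F i = \sum_b \sum_a F (mxtens_index (b, a)).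
Proof.
rewrite pair_big /= (reindex (@mxtens_index m n)) /=.
  by apply: eq_bigr => -[].
by exists (@mxtens_unindex m n) => i _; rewrite (mxtens_indexK, mxtens_unindexK).
Qed.

Section TableInformation.
Context (R : realType) (LX LY J K : nat).
Context (xt : 'I_J.+1 -> 'cV[R]_LX) (yt : 'I_K.+1 -> 'cV[R]_LY).
Local Notation n := (K.+1 * J.+1)%N.

Definition rowof (i : 'I_n) : 'I_J.+1 := (mxtens_unindex i).2.
Definition colof (i : 'I_n) : 'I_K.+1 := (mxtens_unindex i).1.
Definition cell (j : 'I_J.+1) (k : 'I_K.+1) : 'I_n := mxtens_index (k, j).

Lemma rowof_cell j k : rowof (cell j k) = j.
Proof. by rewrite /rowof mxtens_indexK. Qed.

Lemma colof_cell j k : colof (cell j k) = k.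
Proof. by rewrite /colof mxtens_indexK. Qed.

Lemma cellK i : cell (rowof i) (colof i) = i.
Proof. by rewrite /cell -surjective_pairing mxtens_unindexK. Qed.

Lemma sum_cells (F : 'I_n -> R) : \sum_i F i = \sum_j \sum_k F (cell j k).
Proof. by rewrite sum_mxtens exchange_big. Qed.

Lemma sum_row (F : 'I_n -> R) j :
  \sum_(i | rowof i == j) F i = \sum_k F (cell j k).
Proof.
rewrite big_mkcond sum_cells (bigD1 j) //= [X in _ + X]big1 => [|j' /negbTE E].
  by rewrite addr0; apply: eq_bigr => k _; rewrite rowof_cell eqxx.
by apply: big1 => k _; rewrite rowof_cell E.
Qed.

Lemma sum_col (F : 'I_n -> R) k :
  \sum_(i | colof i == k) F i = \sum_j F (cell j k).
Proof.
rewrite big_mkcond sum_cells; apply: eq_bigr => j _.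
rewrite (bigD1 k) //= [X in _ + X]big1 => [|k' /negbTE E].
  by rewrite addr0 colof_cell eqxx.
by rewrite colof_cell E.
Qed.

(** Indicators of the non-reference levels, the design counterpart of [with0]. *)
Definition nzind (q : nat) (g : 'I_n -> 'I_q.+1) : 'M[R]_(n, q) :=
  \matrix_(i, k) (g i == lift ord0 k)%:R.

Lemma nzindE (q : nat) (g : 'I_n -> 'I_q.+1) (v : 'cV[R]_q) i :
  (nzind g *m v) i 0 = with0 v (g i).
Proof.
rewrite mxE /with0; under eq_bigr do rewrite mxE.
case: unliftP => [k ->|->]; last first.
  by apply: big1 => k _; rewrite (negbTE (neq_lift _ _)) mul0r.
rewrite (bigD1 k) //= big1 => [|k' E].
  by rewrite eqxx mul1r addr0.
by rewrite (inj_eq lift_inj) eq_sym (negbTE E) mul0r.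
Qed.

Lemma with0_sub (q : nat) (f : 'I_q.+1 -> R) i :
  with0 (\col_k (f (lift ord0 k) - f ord0)) i = f i - f ord0.
Proof.
by rewrite /with0; case: unliftP => [k ->|->]; rewrite ?mxE ?subrr.
Qed.

Definition Zfull : 'M[R]_(n, LY * LX) :=
  \matrix_(i < n) (z_ xt yt (rowof i) (colof i))^T.

Lemma ZfullE (v : 'cV[R]_(LY * LX)) i :
  (Zfull *m v) i 0 = ((z_ xt yt (rowof i) (colof i))^T *m v) 0 0.
Proof. by rewrite !mxE; apply: eq_bigr => l _; rewrite !mxE. Qed.

Lemma bilin_z (v : 'cV[R]_(LY * LX)) j k :
  bilin (unvec v) (xt j) (yt k) = ((z_ xt yt j k)^T *m v) 0 0.
Proof.
rewrite /bilin mxE [RHS]mxE sum_mxtens; apply: eq_bigr => b _.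
rewrite mxE mulr_suml; apply: eq_bigr => a _.
by rewrite !mxE mxtens_indexK !ord1 /=; ring.
Qed.

(** Conditioning on the row cancels row effects, so only column effects and [theta] remain;
    [coldesign] exchanges the roles. *)
Definition rowdesign : 'M[R]_(n, K + LY * LX) := row_mx (nzind colof) Zfull.
Definition coldesign : 'M[R]_(n, J + LY * LX) := row_mx (nzind rowof) Zfull.

Lemma rowdesignE lam i : (rowdesign *m lam) i 0 =
  with0 (usubmx lam) (colof i) +
  ((z_ xt yt (rowof i) (colof i))^T *m dsubmx lam) 0 0.
Proof. by rewrite -{1}[lam]vsubmxK mul_row_col mxE nzindE ZfullE. Qed.

Lemma coldesignE lam i : (coldesign *m lam) i 0 =
  with0 (usubmx lam) (rowof i) +
  ((z_ xt yt (rowof i) (colof i))^T *m dsubmx lam) 0 0.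
Proof. by rewrite -{1}[lam]vsubmxK mul_row_col mxE nzindE ZfullE. Qed.

(** An arbitrary function of the row is [alpha] plus normalized row effects: its value at the
    reference row is [alpha], its differences from it are the [rho_j]. *)
Lemma spaceH_row h : spaceH xt yt h <->
  exists rho v, h = gind R rowof *m rho + rowdesign *m v.
Proof.
split=> [[alpha [rho [gamma [theta ->]]]]|[rho [v ->]]].
  exists (\col_j (alpha + with0 rho j)), (col_mx gamma (vec theta)).
  apply/matrixP => i j; rewrite ord1 [RHS]mxE gindE rowdesignE.
  by rewrite col_mxKu col_mxKd !mxE !addrA.
exists (rho ord0 0), (\col_j (rho (lift ord0 j) 0 - rho ord0 0)), (usubmx v),
  (unvec (dsubmx v)).
apply/matrixP => i j; rewrite ord1 [LHS]mxE gindE rowdesignE unvecK.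
rewrite [RHS]mxE [RHS]mxE (with0_sub (fun j => rho j 0)).
by rewrite (addrC (rho ord0 0)) subrK addrA.
Qed.

Lemma spaceH_col h : spaceH xt yt h <->
  exists gamma v, h = gind R colof *m gamma + coldesign *m v.
Proof.
split=> [[alpha [rho [gamma [theta ->]]]]|[gamma [v ->]]].
  exists (\col_k (alpha + with0 gamma k)), (col_mx rho (vec theta)).
  apply/matrixP => i j; rewrite ord1 [RHS]mxE gindE coldesignE.
  by rewrite col_mxKu col_mxKd !mxE !addrA [X in X + _]addrAC.
exists (gamma ord0 0), (usubmx v), (\col_k (gamma (lift ord0 k) 0 - gamma ord0 0)),
  (unvec (dsubmx v)).
apply/matrixP => i j; rewrite ord1 [LHS]mxE gindE coldesignE unvecK.
rewrite [RHS]mxE [RHS]mxE (with0_sub (fun j => gamma j 0)).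
by rewrite (addrAC (gamma ord0 0)) (addrC (gamma ord0 0)) subrK addrA.
Qed.

Lemma e_rowE j : e_row R K j = gind R rowof *m delta_mx j 0.
Proof.
apply/matrixP => i l; rewrite ord1 gindE /e_row summxE mxE andbT.
under eq_bigr do rewrite !mxE.
rewrite (bigD1 (colof i)) //= big1 => [|k E].
  by rewrite eqxx andbT addr0 eq_sym.
by rewrite andbC eq_sym (negbTE E).
Qed.

Lemma spaceR_row (h : 'cV[R]_n) : spaceR h <-> exists rho, h = gind R rowof *m rho.
Proof.
split=> [|[rho ->]].
  rewrite /spaceR /= -[X in <<X>>%VS]/(tval (in_tuple _)) => /coord_span ->.
  elim/big_ind: _ => [|u v [a ->] [b ->]|i _].
  - by exists 0; rewrite mulmx0.
  - by exists (a + b); rewrite mulmxDr.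
  have /mapP[j _ ->] : (in_tuple [seq e_row R K j | j : 'I_J.+1])`_i
      \in [seq e_row R K j | j : 'I_J.+1] by exact: mem_nth.
  by rewrite e_rowE scalemxAr; eexists.
rewrite /spaceR /=.
have -> : gind R rowof *m rho = \sum_j rho j 0 *: e_row R K j.
  under eq_bigr do rewrite e_rowE scalemxAr.
  rewrite -mulmx_sumr; congr (_ *m _).
  by rewrite [LHS]matrix_sum_delta; apply: eq_bigr => j _; rewrite big_ord1.
apply: memv_suml => j _; apply: memvZ; apply: memv_span.
by apply: map_f; rewrite mem_enum.
Qed.

Lemma e_E j k : e_ R j k = delta_mx (cell j k) 0.
Proof.
apply/matrixP => i l; rewrite !mxE ord1 andbT -[i in RHS]cellK /cell.
rewrite (inj_eq (can_inj (@mxtens_indexK _ _))) xpair_eqE andbC.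
by rewrite -/(rowof i).
Qed.

(** * Contrasts applied to the designs *)

Lemma e_mul p (h : 'M[R]_(n, p)) j k : (e_ R j k)^T *m h = row (cell j k) h.
Proof. by rewrite e_E trmx_delta -rowE. Qed.

(** The analogue of [Bmx] for grouping by columns: it reads off the row effects along the reference
    column. *)
Definition Bcol : 'M[R]_(n, J) :=
  \matrix_(a, j) (e_ R (lift ord0 j) ord0 - e_ R ord0 ord0) a 0.

Lemma Bmx_mul p (h : 'M[R]_(n, p)) k l : ((Bmx R J K)^T *m h) k l =
  h (cell ord0 (lift ord0 k)) l - h (cell ord0 ord0) l.
Proof.
have -> : ((Bmx R J K)^T *m h) k l =
    ((e_ R ord0 (lift ord0 k) - e_ R ord0 ord0)^T *m h) 0 l.
  by rewrite mxE [RHS]mxE; apply: eq_bigr => i _; rewrite !mxE.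
by rewrite linearB /= mulmxBl !e_mul !mxE.
Qed.

Lemma Bcol_mul p (h : 'M[R]_(n, p)) j l : (Bcol^T *m h) j l =
  h (cell (lift ord0 j) ord0) l - h (cell ord0 ord0) l.
Proof.
have -> : (Bcol^T *m h) j l =
    ((e_ R (lift ord0 j) ord0 - e_ R ord0 ord0)^T *m h) 0 l.
  by rewrite mxE [RHS]mxE; apply: eq_bigr => i _; rewrite !mxE.
by rewrite linearB /= mulmxBl !e_mul !mxE.
Qed.

Lemma Cmx_mul p (h : 'M[R]_(n, p)) i l :
  let j := lift ord0 (mxtens_unindex i).2 in
  let k := lift ord0 (mxtens_unindex i).1 in
  ((Cmx R J K)^T *m h) i l =
  h (cell j k) l + h (cell ord0 ord0) l - h (cell j ord0) l - h (cell ord0 k) l.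
Proof.
move=> j k.
have -> : ((Cmx R J K)^T *m h) i l = ((c_ R j k)^T *m h) 0 l.
  by rewrite mxE [RHS]mxE; apply: eq_bigr => a _; rewrite !mxE.
by rewrite /c_ !linearB linearD /= !mulmxBl mulmxDl !e_mul !mxE.
Qed.

Lemma Bmx_gind : (Bmx R J K)^T *m gind R rowof = 0.
Proof. by apply/matrixP => k l; rewrite Bmx_mul !mxE !rowof_cell subrr. Qed.

Lemma Bcol_gind : Bcol^T *m gind R colof = 0.
Proof. by apply/matrixP => k l; rewrite Bcol_mul !mxE !colof_cell subrr. Qed.

Lemma Cmx_gind_row : (Cmx R J K)^T *m gind R rowof = 0.
Proof. by apply/matrixP => i l; rewrite Cmx_mul !mxE !rowof_cell; ring. Qed.

Lemma Cmx_gind_col : (Cmx R J K)^T *m gind R colof = 0.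
Proof. by apply/matrixP => i l; rewrite Cmx_mul !mxE !colof_cell; ring. Qed.

Lemma Cmx_nzind_row : (Cmx R J K)^T *m nzind rowof = 0.
Proof. by apply/matrixP => i l; rewrite Cmx_mul !mxE !rowof_cell; ring. Qed.

Lemma Cmx_nzind_col : (Cmx R J K)^T *m nzind colof = 0.
Proof. by apply/matrixP => i l; rewrite Cmx_mul !mxE !colof_cell; ring. Qed.

Lemma Bmx_nzind : (Bmx R J K)^T *m nzind colof = 1%:M.
Proof.
apply/matrixP => k l; rewrite Bmx_mul !mxE !colof_cell.
by rewrite (inj_eq lift_inj) (negbTE (neq_lift _ _)) subr0.
Qed.

Lemma Bcol_nzind : Bcol^T *m nzind rowof = 1%:M.
Proof.
apply/matrixP => k l; rewrite Bcol_mul !mxE !rowof_cell.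
by rewrite (inj_eq lift_inj) (negbTE (neq_lift _ _)) subr0.
Qed.

Lemma z_E j k l m : z_ xt yt j k l m =
  yt k (mxtens_unindex l).1 0 * xt j (mxtens_unindex l).2 0.
Proof. by rewrite mxE !ord1. Qed.

Section Reference.
Hypothesis (xt0 : xt ord0 = 0) (yt0 : yt ord0 = 0).

Lemma Bmx_Zfull : (Bmx R J K)^T *m Zfull = 0.
Proof.
apply/matrixP => k l; rewrite Bmx_mul ![Zfull _ _]mxE ![_^T _ _]mxE !z_E.
by rewrite !rowof_cell xt0 !mxE !mulr0 subrr.
Qed.

Lemma Bcol_Zfull : Bcol^T *m Zfull = 0.
Proof.
apply/matrixP => k l; rewrite Bcol_mul ![Zfull _ _]mxE ![_^T _ _]mxE !z_E.
by rewrite !colof_cell yt0 !mxE !mul0r subrr.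
Qed.

(** Of the four terms of each contrast only [z_jk] survives, the others having a zero factor at a
    reference value. *)
Lemma Cmx_Zfull : (Cmx R J K)^T *m Zfull = Zo xt yt.
Proof.
apply/matrixP => i l; rewrite Cmx_mul ![Zfull _ _]mxE ![_^T _ _]mxE !z_E.
rewrite !colof_cell !rowof_cell xt0 yt0 !mxE !(mulr0, mul0r) !ord1.
by rewrite addr0 !subr0.
Qed.

Hypothesis rankX : \rank (\matrix_(j < J) (xt (lift ord0 j))^T) = LX.
Hypothesis rankY : \rank (\matrix_(k < K) (yt (lift ord0 k))^T) = LY.

Lemma Zo_tens : Zo xt yt = (\matrix_(k < K) (yt (lift ord0 k))^T) *t
                           (\matrix_(j < J) (xt (lift ord0 j))^T).
Proof. by apply/matrixP => i l; rewrite !mxE !ord1. Qed.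

(** The Kronecker product of left inverses of the two factors is a left inverse of [Zo]. *)
Lemma Zo_row_free : row_free (Zo xt yt)^T.
Proof.
have /row_fullP[U UX] : row_full (\matrix_(j < J) (xt (lift ord0 j))^T).
  by rewrite /row_full rankX.
have /row_fullP[V VY] : row_full (\matrix_(k < K) (yt (lift ord0 k))^T).
  by rewrite /row_full rankY.
apply/row_freeP; exists (V *t U)^T; rewrite -trmx_mul Zo_tens tensmx_mul VY UX.
rewrite -[RHS]trmx1; congr (_^T); apply/matrixP => i l.
rewrite !mxE -natrM mulnb -xpair_eqE.
by rewrite -!surjective_pairing (inj_eq (can_inj (@mxtens_unindexK _ _))).
Qed.

Lemma Zo_pinvK : Zo_pinv xt yt *m Zo xt yt = 1%:M.
Proof.
rewrite /Zo_pinv -mulmxA mulVmx //.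
have one_gt0 i : 0 < (const_mx 1 : 'rV[R]_(K * J)) 0 i by rewrite mxE.
have := gram_unitmx one_gt0 Zo_row_free.
by rewrite diag_const_mx mulmx1 trmxK.
Qed.

Definition rowcontrast : 'M[R]_(n, K + LY * LX) :=
  row_mx (Bmx R J K) (Cmx R J K *m (Zo_pinv xt yt)^T).

Definition colcontrast : 'M[R]_(n, J + LY * LX) :=
  row_mx Bcol (Cmx R J K *m (Zo_pinv xt yt)^T).

Lemma rowcontrast_design : rowcontrast^T *m rowdesign = 1%:M.
Proof.
rewrite tr_row_mx mul_col_row trmx_mul trmxK.
rewrite -!(mulmxA (Zo_pinv _ _)) Cmx_nzind_col Cmx_Zfull.
by rewrite Bmx_nzind Bmx_Zfull mulmx0 Zo_pinvK -scalar_mx_block.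
Qed.

Lemma colcontrast_design : colcontrast^T *m coldesign = 1%:M.
Proof.
rewrite tr_row_mx mul_col_row trmx_mul trmxK.
rewrite -!(mulmxA (Zo_pinv _ _)) Cmx_nzind_row Cmx_Zfull.
by rewrite Bcol_nzind Bcol_Zfull mulmx0 Zo_pinvK -scalar_mx_block.
Qed.

Lemma rowcontrast_gind : rowcontrast^T *m gind R rowof = 0.
Proof.
rewrite tr_row_mx mul_col_mx trmx_mul trmxK.
rewrite -!(mulmxA (Zo_pinv _ _)) Cmx_gind_row Bmx_gind.
by rewrite mulmx0 col_mx0.
Qed.

Lemma colcontrast_gind : colcontrast^T *m gind R colof = 0.
Proof.
rewrite tr_row_mx mul_col_mx trmx_mul trmxK.
rewrite -!(mulmxA (Zo_pinv _ _)) Cmx_gind_col Bcol_gind.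
by rewrite mulmx0 col_mx0.
Qed.

(** * Information matrices of the two table likelihoods *)

Context (r : 'M[nat]_(J.+1, K.+1)).
Local Notation rvec := (fun i => (r (rowof i) (colof i))%:R : R).

Lemma loglik_grouped : loglik xt yt r = gloglik rowof rowdesign rvec.
Proof.
apply/funext => lam; rewrite /gloglik sum_cells.
apply: eq_bigr => j _; apply: eq_bigr => k _; rewrite rowof_cell colof_cell.
congr (_ * ln _); rewrite /pstar /gprob /gtotal rowof_cell sum_row.
rewrite rowdesignE rowof_cell colof_cell bilin_z; congr (_ / _).
by apply: eq_bigr => k' _; rewrite rowdesignE rowof_cell colof_cell bilin_z.
Qed.

Lemma fin_loglik_grouped : fin_loglik xt yt r = gloglik colof coldesign rvec.
Proof.
apply/funext => lam; rewrite /gloglik sum_cells.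
apply: eq_bigr => j _; apply: eq_bigr => k _; rewrite rowof_cell colof_cell.
congr (_ * ln _); rewrite /fin_prob /gprob /gtotal colof_cell sum_col.
rewrite coldesignE rowof_cell colof_cell; congr (_ / _).
by apply: eq_bigr => j' _; rewrite coldesignE rowof_cell colof_cell.
Qed.

Hypothesis row_gt0 : forall j, (0 < \sum_k r j k)%N.
Hypothesis col_gt0 : forall k, (0 < \sum_j r j k)%N.

Lemma gsize_row i : 0 < gsize rowof rvec i.
Proof.
rewrite /gsize sum_row; under eq_bigr do rewrite rowof_cell colof_cell.
by rewrite -natr_sum ltr0n.
Qed.

Lemma gsize_col i : 0 < gsize colof rvec i.
Proof.
rewrite /gsize sum_col; under eq_bigr do rewrite rowof_cell colof_cell.
by rewrite -natr_sum ltr0n.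
Qed.

Context (mu : 'M[R]_(J.+1, K.+1)) (mu_ml : is_ml_table xt yt r mu).

Lemma ml_table_gt0 i : 0 < (vec mu) i 0.
Proof. by rewrite mxE; case: mu_ml. Qed.

Lemma ml_table_spaceH : spaceH xt yt (\col_i ln (vec mu i 0)).
Proof.
case: mu_ml => _ muH _.
suff -> : \col_i ln (vec mu i 0) = vec (\matrix_(j, k) ln (mu j k)) by [].
by apply/matrixP => i j; rewrite !mxE.
Qed.

Lemma spaceH_oproj (d : 'rV[R]_n) : (forall i, 0 < d 0 i) ->
  is_oproj (diag_mx d) (spaceH xt yt) (oproj (diag_mx d) (spaceH xt yt)).
Proof.
move=> d_gt0; apply: (@oprojP _ _ _ d_gt0 _ (row_mx (gind R rowof) rowdesign)).
move=> h; rewrite spaceH_row; split=> [[rho [v ->]]|[v ->]].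
  by exists (col_mx rho v); rewrite mul_row_col.
by exists (usubmx v), (dsubmx v); rewrite -mul_row_col vsubmxK.
Qed.

Lemma spaceR_oproj (d : 'rV[R]_n) : (forall i, 0 < d 0 i) ->
  is_oproj (diag_mx d) (spaceR (J := J) (K := K))
    (oproj (diag_mx d) (spaceR (J := J) (K := K))).
Proof. by move=> d_gt0; apply: (oprojP d_gt0 (@spaceR_row)). Qed.

(** Both tables have the same projection onto [spaceH], so their difference is a difference of two
    residuals orthogonal to it. *)
Lemma ml_table_score h : spaceH xt yt h ->
  (vec mu - \col_i rvec i)^T *m h = 0.
Proof.
move=> Hh; case: mu_ml => _ _ muP.
have one_gt0 i : 0 < (const_mx 1 : 'rV[R]_n) 0 i by rewrite mxE.
have := (spaceH_oproj one_gt0).2; rewrite diag_const_mx => PP.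
have -> : \col_i rvec i = vec (\matrix_(j, k) (r j k)%:R).
  by apply/matrixP => i j; rewrite !mxE.
set s := vec (\matrix_(_, _) _) in muP *.
have := PP (vec mu) h Hh; have := PP s h Hh; rewrite !mulmx1 muP.
set p := _ *m s => Es Em.
have -> : vec mu - s = (vec mu - p) - (s - p) by rewrite opprB addrA subrK.
by rewrite linearB /= mulmxBl Es Em subrr.
Qed.

Local Notation D := (diag_mx (vec mu)^T).
Local Notation PH := (oproj D (spaceH xt yt)).

Lemma observed_info_mul lam : is_maximizer (loglik xt yt r) lam ->
  observed_info xt yt r lam *m
    (rowcontrast^T *m PH *m invmx D *m rowcontrast) = 1%:M.
Proof.
rewrite /observed_info loglik_grouped => lam_max.
apply: ginfo_mul => //.
- exact: gsize_row.
- exact: spaceH_row.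
- exact: rowcontrast_design.
- exact: rowcontrast_gind.
- exact: ml_table_gt0.
- exact: ml_table_spaceH.
- exact: ml_table_score.
Qed.

Lemma fin_observed_info_mul lam : is_maximizer (fin_loglik xt yt r) lam ->
  fin_observed_info xt yt r lam *m
    (colcontrast^T *m PH *m invmx D *m colcontrast) = 1%:M.
Proof.
rewrite /fin_observed_info fin_loglik_grouped => lam_max.
apply: ginfo_mul => //.
- exact: gsize_col.
- exact: spaceH_col.
- exact: colcontrast_design.
- exact: colcontrast_gind.
- exact: ml_table_gt0.
- exact: ml_table_spaceH.
- exact: ml_table_score.
Qed.

(* The contrasts annihilate the row space, so its projection drops out. *)
Lemma Sigma_hatE :
  Sigma_hat xt yt mu = rowcontrast^T *m PH *m invmx D *m rowcontrast.
Proof.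
have d_gt0 i : 0 < (vec mu)^T 0 i by rewrite mxE ml_table_gt0.
have EG : col_mx (Bmx R J K)^T (Zo_pinv xt yt *m (Cmx R J K)^T) = rowcontrast^T.
  by rewrite tr_row_mx trmx_mul trmxK.
rewrite /Sigma_hat EG mulmxBr; set PR := oproj _ (@spaceR _ _ _).
suff -> : rowcontrast^T *m PR = 0 by rewrite subr0.
apply: mulmx_bilin_eq0 => v w.
have [rho Pw] := (spaceR_row _).1 ((spaceR_oproj d_gt0).1 w).
by rewrite -!mulmxA Pw (mulmxA _ (gind _ _)) rowcontrast_gind mul0mx mulmx0.
Qed.

(** Leaving [B] arbitrary covers both groupings, whose contrasts share the block for [theta]. *)
Lemma drsubmx_contrast (k : nat) (B : 'M[R]_(n, k)) :
  let G := row_mx B (Cmx R J K *m (Zo_pinv xt yt)^T) in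
  drsubmx (G^T *m PH *m invmx D *m G) = Sigma_theta xt yt mu.
Proof.
move=> G; rewrite -(mulmxA _ PH) drsubmx_form /Sigma_theta trmx_mul trmxK.
by rewrite !mulmxA.
Qed.

End Reference.

End TableInformation.

(** * The observed sample and comparison of the two covariance estimates *)

Theorem mainTheorem6 (R : realType) (dX dY dO : measure_display)
  (X : measurableType dX) (Y : measurableType dY)
  (LX LY J K : nat) (J_gt0 : (0 < J)%N) (K_gt0 : (0 < K)%N)
  (* the odds ratio model *)
  (nuX : {sigma_finite_measure set X -> \bar R})
  (nuY : {sigma_finite_measure set Y -> \bar R})
  (p : X -> Y -> R) (p_density : joint_density nuX nuY p)
  (hX : X -> 'cV[R]_LX) (hY : Y -> 'cV[R]_LY)
  (hX_meas : forall i, measurable_fun [set: X] (fun u => hX u i 0))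
  (hY_meas : forall i, measurable_fun [set: Y] (fun v => hY v i 0))
  (x : 'I_J.+1 -> X) (y : 'I_K.+1 -> Y)
  (hX0 : hX (x ord0) = 0) (hY0 : hY (y ord0) = 0)
  (theta : 'M[R]_(LX, LY))
  (model : forall u v,
     log_odds_ratio p (x ord0) (y ord0) u v = bilin theta (hX u) (hY v))
  (* sampling conditional on Y, observed at the outcome w *)
  (y_inj : injective y)
  (m : 'I_K.+1 -> nat) (m_gt0 : forall k, (0 < m k)%N)
  (Om : measurableType dO) (P : probability Om R)
  (S : forall k, 'I_(m k) -> Om -> X)
  (sampling : sample_conditional_on_Y P nuX p y S)
  (w : Om)
  (x_inj : injective x)
  (x_obs : range x = [set u | exists k i, S k i w = u])
  (r : 'M[nat]_(J.+1, K.+1))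
  (r_def : forall j k, r j k = #|[pred i | S k i w == x j]|)
  (* rank conditions *)
  (rankX : \rank (\matrix_(j < J) (hX (x (lift ord0 j)))^T) = LX)
  (rankY : \rank (\matrix_(k < K) (hY (y (lift ord0 k)))^T) = LY)
  (* maximum likelihood estimates *)
  (lam : 'cV[R]_(K + LY * LX))
  (lam_mle : is_maximizer (loglik (hX \o x) (hY \o y) r) lam)
  (mu : 'M[R]_(J.+1, K.+1))
  (mu_mle : is_ml_table (hX \o x) (hY \o y) r mu) :
  let Jhat := observed_info (hX \o x) (hY \o y) r lam in
  [/\ Jhat \in unitmx,
      invmx Jhat = Sigma_hat (hX \o x) (hY \o y) mu,
      drsubmx (invmx Jhat) = Sigma_theta (hX \o x) (hY \o y) mu
    & forall lam_fin : 'cV[R]_(J + LY * LX),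
        is_maximizer (fin_loglik (hX \o x) (hY \o y) r) lam_fin ->
        let Jfin := fin_observed_info (hX \o x) (hY \o y) r lam_fin in
        Jfin \in unitmx /\ drsubmx (invmx Jfin) = drsubmx (invmx Jhat)].
Proof.
have cell_obs j k i : S k i w = x j -> (0 < r j k)%N.
  by move=> Sx; rewrite r_def; apply/card_gt0P; exists i; rewrite inE Sx.
(* Every listed [x j] was observed in some draw, so no row of the table is empty. *)
have row_gt0 j : (0 < \sum_k r j k)%N.
  have : range x (x j) by exists j.
  rewrite x_obs => -[k [i /cell_obs rjk]].
  by rewrite (bigD1 k) //= ltn_addr.
have col_gt0 k : (0 < \sum_j r j k)%N.
  (* The first draw at [y k] exists as the sample size is positive; its value is some [x j]. *)
  pose i := Ordinal (m_gt0 k).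
  have : [set u | exists k i, S k i w = u] (S k i w) by exists k, i.
  rewrite -x_obs => -[j _ /esym/cell_obs rjk].
  by rewrite (bigD1 j) //= ltn_addr.
move=> Jhat.
have inv_of (N : nat) (U V : 'M[R]_N) : U *m V = 1%:M -> U \in unitmx /\ invmx U = V.
  by move=> UV; have [Uu _] := mulmx1_unit UV; rewrite -[V](mulKmx Uu) UV mulmx1.
have [Ju JV] := inv_of _ _ _
  (observed_info_mul hX0 hY0 rankX rankY row_gt0 mu_mle lam_mle).
have JT : drsubmx (invmx Jhat) = Sigma_theta (hX \o x) (hY \o y) mu.
  by rewrite JV; exact: drsubmx_contrast.
split=> //; first by rewrite (Sigma_hatE mu_mle).
move=> lam_fin fin_mle Jfin.
have [Fu FV] := inv_of _ _ _
  (fin_observed_info_mul hX0 hY0 rankX rankY col_gt0 mu_mle fin_mle).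
by split=> //; rewrite JT FV; exact: drsubmx_contrast.
Qed.
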